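(* Let $r\ge 1$ and $k\ge 1$ be integers with $rk\ge 3$ and $k\neq 1$. Then $$E_k^r(x)=\Omega(x^{k-1}),$$ where $E_k^r(x)=V_k^r(x)-\dfrac{(2x)^k}{\zeta(rk)}$ and $V_k^r(x)$ is the number of relatively $r$-prime $k$-tuples of integers in $[-x,x]^k$.
   Context: For a fixed integer $r\ge 1$ and integers $x_1,\ldots,x_k$, not all zero, $(x_1,\ldots,x_k)_r$ denotes the largest positive integer $n$ such that $n^r$ divides every $x_i$. Thus $(x_1,\ldots,x_k)_r=1$ means that there is no prime $p$ such that $p^r$ divides all of $x_1,\ldots,x_k$; the tuple is then called relatively $r$-prime. The zero tuple is not relatively $r$-prime. For real $x>0$, $V_k^r(x)$ denotes the number of $k$-tuples of integers $(x_1,\ldots,x_k)$ with $(x_1,\ldots,x_k)_r=1$ and $|x_i|\le x$ for all $i=1,\ldots,k$. $\zeta$ is the Riemann zeta function. The symbol $\Omega$ is that of Hardy and Littlewood: $f(x)=\Omega(g(x))$ means $\limsup_{x\to\infty}\left|\frac{f(x)}{g(x)}\right|>0$. *)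

(* Defs.v *)
From mathcomp Require Import all_boot all_order all_algebra finmap.
From mathcomp Require Import all_classical all_reals all_analysis.

Set Implicit Arguments.
Unset Strict Implicit.
Unset Printing Implicit Defensive.

Import Order.TTheory GRing.Theory Num.Theory.
Import numFieldNormedType.Exports.

Local Open Scope classical_set_scope.
Local Open Scope ring_scope.

Definition rpow_dvd (k r : nat) (u : k.-tuple int) (n : nat) : Prop :=
  (0 < n)%N /\ forall i : 'I_k, ((n ^ r)%N%:Z %| tnth u i)%Z.

(* [is_rgcd r u n] means (u_1, ..., u_k)_r = n. It is a relation because the
   zero tuple has no largest such n. *)
Definition is_rgcd (k r : nat) (u : k.-tuple int) (n : nat) : Prop :=
  rpow_dvd r u n /\ forall m : nat, rpow_dvd r u m -> (m <= n)%N.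

Definition rel_prime (k r : nat) (u : k.-tuple int) : Prop := is_rgcd r u 1.

Definition rel_prime_box (R : realType) (k r : nat) (x : R) :
    set (k.-tuple int) :=
  [set u | rel_prime r u /\ forall i : 'I_k, `|tnth u i|%:~R <= x].
Arguments rel_prime_box {R} k r x.

(* [fset_set] is meaningful here by [finite_rel_prime_box]. *)
Definition Vkr (R : realType) (k r : nat) (x : R) : nat :=
  #|` fset_set (rel_prime_box k r x)|.
Arguments Vkr {R} k r x.

(* The Dirichlet series, hence the Riemann zeta function only for 1 < s. *)
Definition zeta (R : realType) (s : R) : R := limn (series (riemannR s)).

Definition Ekr (R : realType) (k r : nat) (x : R) : R :=
  (Vkr k r x)%:R - (2 * x) ^+ k / zeta ((r * k)%N%:R : R).
Arguments Ekr {R} k r x.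

(* Weaker than the library's [f =Omega_+oo g], which asks for
   |g| <= C * |f| at all large x. *)
Definition HL_Omega (R : realType) (f g : R -> R) : Prop :=
  (0 < limf_esup (fun x : R => `|f x / g x|%:E) (+oo%R : set_system R))%E.

Lemma not_rel_prime0 (k r : nat) :
  ~ rel_prime r [tuple (0 : int) | _ < k].
Proof.
move=> [_ /(_ 2%N) max1].
suff /max1 : rpow_dvd r [tuple (0 : int) | _ < k] 2 by [].
by split=> // i; rewrite tnth_mktuple dvdz0.
Qed.

Lemma finite_rel_prime_box (R : realType) (k r : nat) (x : R) :
  finite_set (rel_prime_box k r x).
Proof.
pose N := Num.truncn `|x|.
pose h (t : k.-tuple 'I_(N + N).+1) : k.-tuple int :=
  [tuple (nat_of_ord (tnth t i))%:Z - N%:Z | i < k].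
apply: (@sub_finite_set _ _ (h @` setT)); last first.
  by apply: finite_image; exact: finite_finset.
move=> u [_ ux]; pose g (i : 'I_k) := absz (tnth u i + N%:Z).
have uN i : `|tnth u i| <= N%:Z.
  have := le_trans (ux i) (ler_norm x).
  by rewrite -abszE lez_nat -pmulrn -truncn_ge_nat.
exists [tuple inord (g i) | i < k] => //.
apply: eq_from_tnth => i; rewrite !tnth_mktuple.
have := uN i; rewrite ler_norml => /andP[l1 l2].
have gE : (g i)%:Z = tnth u i + N%:Z.
  by rewrite /g abszE ger0_norm// -lerBlDr sub0r.
rewrite inordK ?gE ?addrK//.
by rewrite ltnS -lez_nat gE PoszD lerD2r.
Qed.

(* Main.v *)
Require Import Defs.
From mathcomp Require Import all_boot all_order all_algebra.
From mathcomp Require Import all_classical all_reals all_analysis.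
From mathcomp Require Import ring lra.

(* The count V is constant on [n, n + 1), while the main term (2 x)^k / zeta(r k)
   grows there by at least a constant times n^(k - 1).  Hence E cannot be
   o(x^(k - 1)) both along x = n and along x = n + 1/2. *)

Import Order.TTheory GRing.Theory Num.Theory.
Import numFieldNormedType.Exports.

Local Open Scope classical_set_scope.
Local Open Scope ring_scope.

(** Since [2 <= s] and [n + 2 <= 2 (n + 1)], the term is at most
    [1 / (n + 1)^2 <= 2 / ((n + 1) (n + 2))], which telescopes. *)
Lemma riemannR_le_telescope (R : realType) (s : R) (n : nat) : 2 <= s ->
  riemannR s n <= 2 / n.+1%:R - 2 / n.+2%:R.
Proof.
move=> s2; rewrite /riemannR.
apply: (@le_trans _ _ (n.+1%:R ^+ 2)^-1).
  rewrite lef_pV2 ?posrE ?exprn_gt0 ?powR_gt0 ?ltr0n//.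
  by rewrite -powR_mulrn ?ler0n// ler_powR// ler1n.
have n0 : 0 <= n%:R :> R by rewrite ler0n.
have -> : 2 / n.+1%:R - 2 / n.+2%:R = 2 / (n.+1%:R * n.+2%:R) :> R.
  by rewrite -[n.+2]addn2 -[n.+1]addn1 !natrD; field; lra.
rewrite -[leLHS]div1r ler_pdivrMr ?exprn_gt0 ?ltr0n// mulrAC.
rewrite ler_pdivlMr ?mulr_gt0 ?ltr0n//.
by rewrite -[n.+2]addn2 -[n.+1]addn1 !natrD; nra.
Qed.

Lemma series_riemannR_le2 (R : realType) (s : R) (n : nat) : 2 <= s ->
  series (riemannR s) n <= 2.
Proof.
(* The induction needs the sharper telescoped bound; the series sums the terms of index below
   [n]. *)
move=> s2; suff : series (riemannR s) n <= 2 - 2 / n.+1%:R.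
  by move/le_trans; apply; rewrite gerBl divr_ge0.
elim: n => [|n IHn]; first by rewrite seriesEnat/= big_nil divr1 subrr.
rewrite seriesSr; apply: le_trans (lerD IHn (@riemannR_le_telescope R s n s2)) _.
by rewrite addrA subrK.
Qed.

(** As [zeta] is a [limn], convergence comes first: the partial sums increase and are bounded by 2.
    The limit is then at least the first term. *)
Lemma zeta_gt0 (R : realType) (s : R) : 2 <= s -> 0 < zeta s.
Proof.
move=> s2; have s0 : 0 <= s by lra.
have nd : nondecreasing_seq (series (riemannR s)).
  apply/nondecreasing_seqP => n.
  by rewrite seriesSr lerDl ltW// riemannR_gt0.
have cv : cvgn (series (riemannR s)).
  apply: nondecreasing_is_cvgn => //.
  by exists 2 => _ [n _ <-]; exact: series_riemannR_le2.
apply: lt_le_trans (nondecreasing_cvgn_le nd cv 1%N).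
by rewrite seriesSr seriesEnat/= big_nil add0r; exact: riemannR_gt0.
Qed.

(** An integer is at most [x] exactly when it is at most the floor of [x]. *)
Lemma eq_floor_Vkr (R : realType) (k r : nat) (x y : R) :
  Num.floor x = Num.floor y -> Vkr k r x = Vkr k r y.
Proof.
move=> xy; rewrite /Vkr.
suff -> : rel_prime_box k r x = rel_prime_box k r y by [].
by apply/seteqP; split=> u [ru ux]; split=> // i; move: (ux i);
   rewrite -!floor_ge_int xy.
Qed.

(** The counts cancel, leaving [c ((n + 1/2)^k - n^k)]; bounding [(n + 1/2)^k] below by
    [(n + 1/2) n^(k - 1)] gives the claim. *)
Lemma Ekr_jump (R : realType) (r k n : nat) : (0 < k)%N ->
  let c := 2 ^+ k / zeta ((r * k)%N%:R : R) in
  0 <= c ->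
  c * n%:R ^+ (k - 1) / 2 <= Ekr k r (n%:R : R) - Ekr k r (n%:R + 2^-1 : R).
Proof.
move=> k0 c c0; have n0 : 0 <= n%:R :> R by rewrite ler0n.
have -> : Ekr k r (n%:R : R) - Ekr k r (n%:R + 2^-1 : R) =
    c * ((n%:R + 2^-1) ^+ k - n%:R ^+ k).
  rewrite /Ekr (@eq_floor_Vkr _ _ _ (n%:R + 2^-1) n%:R); last first.
    have floorE (t : R) : 0 <= t < 1 -> Num.floor (n%:R + t) = n%:Z.
      move=> /andP[t0 t1]; apply: floor_def.
      by rewrite intrD -pmulrn; apply/andP; split; lra.
    by rewrite -[n%:R in RHS]addr0 !floorE//; lra.
  by rewrite !exprMn /c; ring.
rewrite -mulrA ler_wpM2l//.
rewrite -[in X in _ <= X - _](subnK k0) -[in X in _ <= _ - X](subnK k0) !addn1.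
rewrite !exprS.
suff : n%:R ^+ (k - 1) <= (n%:R + 2^-1) ^+ (k - 1) :> R by nra.
by rewrite lerXn2r ?nnegrE//; lra.
Qed.

Theorem theorem4p1 (R : realType) (r k : nat) (hr : (1 <= r)%N)
    (hk : (1 <= k)%N) (hrk : (3 <= r * k)%N) (hk1 : k <> 1%N) :
  HL_Omega (Ekr k r) (fun x : R => x ^+ (k - 1)).
Proof.
pose c := 2 ^+ k / zeta ((r * k)%N%:R : R).
have c0 : 0 < c.
  by rewrite divr_gt0 ?exprn_gt0// zeta_gt0// ler_nat ltnW.
(* [d] bounds [((n + 1/2) / n)^(k - 1)] for [n >= 1]; [e] is chosen so that [e (1 + d)] is the jump
   constant [c / 2]. *)
pose d := 2 ^+ (k - 1) : R.
have d0 : 0 < d by rewrite exprn_gt0.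
pose e := c / 2 / (1 + d).
have e0 : 0 < e by apply: divr_gt0; lra.
have ed : e * (1 + d) = c / 2 by rewrite divfK// gt_eqF// addr_gt0.
rewrite /HL_Omega limf_esupE; apply: (@lt_le_trans _ _ e%:E).
  by rewrite lte_fin.
(* The limsup is an infimum of suprema over neighbourhoods of infinity, so one point with ratio at
   least [e] beyond each [M] suffices. *)
apply: le_ereal_inf_tmp => _ [V [M [Mreal MV]] <-].
suff [x Mx ex] : exists2 x, M < x & e <= `|Ekr k r x / x ^+ (k - 1)|.
  apply: le_trans (ereal_sup_ubound _); last by exists x => //; exact: MV.
  by rewrite lee_fin.
pose n := (Num.truncn `|M|).+1.
have Mn : M < n%:R by rewrite (le_lt_trans (ler_norm M))// truncnS_gt.
have n1 : 1 <= n%:R :> R by rewrite ler1n.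
have [?|lt1] := leP e `|Ekr k r (n%:R : R) / n%:R ^+ (k - 1)|; first by exists n%:R.
exists (n%:R + 2^-1); first by lra.
rewrite leNgt; apply/negP => lt2.
have jump := @Ekr_jump R r k n hk (ltW c0).
move: lt1 lt2; rewrite !normrM !normfV.
set E1 := Ekr k r _ in jump *; set E2 := Ekr k r _ in jump *.
set a := n%:R ^+ (k - 1) in jump *; set b := _ ^+ (k - 1).
have a0 : 0 < a by rewrite exprn_gt0//; lra.
have b0 : 0 < b by rewrite exprn_gt0//; lra.
have bda : b <= d * a.
  by rewrite -exprMn lerXn2r ?nnegrE//; lra.
rewrite (gtr0_norm a0) (gtr0_norm b0) !ltr_pdivrMr// => lt1 lt2.
have : e * b <= e * (d * a) by rewrite ler_wpM2l// ltW.
have ce : c * a / 2 = e * a + e * (d * a).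
  by rewrite mulrAC -ed mulrDr mulr1 mulrDl mulrA.
rewrite -/c ce in jump.
(* [E1 - E2 <= |E1| + |E2| < e a + e b <= e (1 + d) a = c a / 2] contradicts [jump]. *)
have := ler_norm E1; have := ler_norm (- E2); rewrite normrN; lra.
Qed.
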